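(* Let $R$ be a fixed finite set of positive integers. A value $\alpha\in[0,|R|]$ is not a strong jump for $R$ if and only if there exists a hereditary property $\mathcal P$ of $R$-graphs with $\pi(\mathcal P)=\alpha$.
   Context: A hypergraph is a pair $(V,E)$ with $E\subseteq 2^V$; it is an $R$-graph if all edge sizes lie in $R$. For an $R$-graph $G$ on $n$ vertices, $h_n(G)=\sum_{e\in E(G)}1/\binom{n}{|e|}$. A property of $R$-graphs is a family of $R$-graphs closed under isomorphism; it is hereditary if it is closed under taking induced subgraphs. For a hereditary property $\mathcal P$, $\mathcal P_n$ is the set of members with $n$ vertices, $\pi_n(\mathcal P)=\max_{G\in\mathcal P_n}h_n(G)$, and $\pi(\mathcal P)=\lim_{n\to\infty}\pi_n(\mathcal P)$ (this limit exists). A value $\alpha$ is a strong jump for $R$ if there exists $c>0$ such that for every integer $t\ge\max R$ there is $n_0$ such that whenever $n\ge n_0$ and $G_n$ is an $R$-graph on $n$ vertices with $h_n(G_n)\ge\alpha-c$, $G_n$ contains a subgraph $H_t$ on $t$ vertices with $h_t(H_t)\ge\alpha+c$. *)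

(* Defs.v *)
From mathcomp Require Import all_boot all_order all_algebra finmap.
From mathcomp Require Import all_classical all_reals all_analysis.

Set Implicit Arguments.
Unset Strict Implicit.
Unset Printing Implicit Defensive.

Import Order.TTheory GRing.Theory Num.Theory.
Import numFieldNormedType.Exports.

Local Open Scope ring_scope.

Record hypergraph := Hypergraph {
  vert : finType;
  edges : {set {set vert}} }.

Definition is_Rgraph (R : {fset nat}) (G : hypergraph) : Prop :=
  forall e, e \in edges G -> #|e| \in R.

Definition hn (F : realType) (G : hypergraph) : F :=
  \sum_(e in edges G) ('C(#|vert G|, #|e|)%:R)^-1.

Definition isomorphic (G H : hypergraph) : Prop :=
  exists2 f : vert G -> vert H, bijective f &
    forall e : {set vert G}, (f @: e \in edges H) = (e \in edges G).

Definition induced_subgraph (G : hypergraph) (S : {set vert G}) : hypergraph :=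
  @Hypergraph {x : vert G | x \in S}
    [set e : {set {x : vert G | x \in S}} | val @: e \in edges G]%SET.

(* Subgraphs need not be induced, and are taken up to isomorphism: [G] contains
   a copy of [H]. *)
Definition subgraph (H G : hypergraph) : Prop :=
  exists2 f : vert H -> vert G, injective f &
    forall e : {set vert H}, e \in edges H -> f @: e \in edges G.

Definition is_property (R : {fset nat}) (P : hypergraph -> Prop) : Prop :=
  (forall G, P G -> is_Rgraph R G) /\
  (forall G H, isomorphic G H -> P G -> P H).

Definition hereditary (P : hypergraph -> Prop) : Prop :=
  forall G (S : {set vert G}), P G -> P (induced_subgraph S).

Definition members (P : hypergraph -> Prop) (n : nat) (G : hypergraph) : Prop :=
  P G /\ #|vert G| = n.

(* The maximum defining pi_n(P) exists and equals [x]; in particular some member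
   of [P] has [n] vertices. *)
Definition is_pi_n (F : realType) (P : hypergraph -> Prop) (n : nat) (x : F) :
    Prop :=
  (exists2 G, members P n G & hn F G = x) /\
  (forall G, members P n G -> hn F G <= x).

Definition is_pi (F : realType) (P : hypergraph -> Prop) (a : F) : Prop :=
  exists2 u : nat -> F, forall n, is_pi_n P n (u n) &
    (u n @[n --> \oo] --> a)%classic.

(* [\max_(r <- R) r] is 0 when [R] is empty. *)
Definition strong_jump (F : realType) (R : {fset nat}) (a : F) : Prop :=
  exists2 c : F, 0 < c &
    forall t : nat, (\max_(r <- R) r <= t)%N ->
    exists n0 : nat, forall G : hypergraph,
      (n0 <= #|vert G|)%N -> is_Rgraph R G -> a - c <= hn F G ->
      exists H : hypergraph,
        [/\ subgraph H G, #|vert H| = t & a + c <= hn F H].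

(* Main.v *)
Require Import Defs.
From mathcomp Require Import all_boot all_order all_algebra finmap.
From mathcomp Require Import all_classical all_reals all_analysis.
From mathcomp Require Import ring lra zify.

(** If [P] is hereditary with density [a], a jump at [a] would turn large members
    of [P] into members of size [t] whose density exceeds [a] by a constant.

    Conversely, let [a] not be a strong jump.  For each [i] there are arbitrarily
    large graphs of density close to [a] without denser subgraphs of some size
    [t = t(i)]; the point is to control the subgraphs of size below [t] as well.
    Fix [s j] large in terms of [1 / j].  If a positive proportion of the
    [s j]-sets had density at least [a + 1 / j], Erdos's theorem on complete
    multipartite hypergraphs would yield a blow-up of a single graph on [s j]
    vertices with that density, and blowing up loses only a factor
    [1 - O(1 / s j)] of the density: this gives a [t]-set of density above
    [a + 1 / (2 j)].  So such [s j]-sets are rare, and a first-moment argument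
    finds an induced subgraph [K i] with none of them for [j <= i] and density at
    least [a - 1 / i].  The induced subgraphs of all the [K i] form the required
    hereditary property. *)

Set Implicit Arguments.
Unset Strict Implicit.
Unset Printing Implicit Defensive.

Import Order.TTheory GRing.Theory Num.Theory.

Local Open Scope ring_scope.

(** * Densities of weighted set systems *)

(** Weights of any sign are allowed, so that edge density minus a penalty is again a density; for
    the indicator of the edges this is [hn] of the subgraph induced on [S]. *)
Definition dens (F : realType) (V : finType) (g : {set V} -> F) (S : {set V}) : F :=
  \sum_(e : {set V} | e \subset S) g e / ('C(#|S|, #|e|))%:R.

Lemma dens_imset (F : realType) (T V : finType) (f : T -> V) (g : {set V} -> F)
    (A : {set T}) :
  injective f -> dens g (f @: A) = dens (fun e => g (f @: e)) A.
Proof.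
move=> f_inj; rewrite /dens (reindex_onto (fun e : {set T} => f @: e)
  (fun e => f @^-1: e)) /=; last first.
  move=> e /fintype.subsetP eA; apply/setP => x; apply/imsetP/idP => [[y]|xe].
    by rewrite inE => ? ->.
  by have /imsetP[y _ xy] := eA _ xe; exists y => //; rewrite inE -xy.
apply: eq_big => [e|e _]; last by rewrite !card_imset.
rewrite (_ : f @^-1: (f @: e) = e) ?eqxx ?andbT.
  apply/idP/idP => [/fintype.subsetP sub|]; last exact: imsetS.
  by apply/fintype.subsetP => x xe; have := sub _ (imset_f f xe); rewrite mem_imset.
by apply/setP => x; rewrite inE mem_imset.
Qed.

Lemma eq_dens (F : realType) (V : finType) (g g' : {set V} -> F) (S : {set V}) :
  g =1 g' -> dens g S = dens g' S.
Proof. by move=> gg'; apply: eq_bigr => e _; rewrite gg'. Qed.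

Lemma le_dens (F : realType) (V : finType) (g g' : {set V} -> F) (S : {set V}) :
  (forall e, g e <= g' e) -> dens g S <= dens g' S.
Proof. by move=> gg'; apply: ler_sum => e _; rewrite ler_wpM2r // invr_ge0. Qed.

Lemma dens_ge0 (F : realType) (V : finType) (g : {set V} -> F) (S : {set V}) :
  (forall e, 0 <= g e) -> 0 <= dens g S.
Proof. by move=> g0; apply: sumr_ge0 => e _; rewrite mulr_ge0 // invr_ge0. Qed.

Lemma densB (F : realType) (V : finType) (g h : {set V} -> F) (S : {set V}) :
  dens (fun e => g e - h e) S = dens g S - dens h S.
Proof. by rewrite /dens -sumrB; apply: eq_bigr => e _; rewrite mulrBl. Qed.

Lemma densZ (F : realType) (V : finType) (c : F) (g : {set V} -> F) (S : {set V}) :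
  dens (fun e => c * g e) S = c * dens g S.
Proof. by rewrite /dens mulr_sumr; apply: eq_bigr => e _; rewrite mulrA. Qed.

Lemma dens_sum (F : realType) (V I : finType) (g : I -> {set V} -> F) (S : {set V}) :
  dens (fun e => \sum_i g i e) S = \sum_i dens (g i) S.
Proof. by rewrite /dens exchange_big; apply: eq_bigr => e _; rewrite mulr_suml. Qed.

(** Double counting: a set [e] with [r] elements survives [n + 1 - r] deletions, and [(n + 1 - r)
    C(n + 1, r) = (n + 1) C(n, r)]. The support condition excludes [e = S], which survives none. *)
Lemma sum_dens_setD1 (F : realType) (V : finType) (g : {set V} -> F) (S : {set V})
    (n : nat) :
  #|S| = n.+1 -> (forall e, g e != 0 -> (#|e| <= n)%N) ->
  \sum_(v in S) dens g (S :\ v) = n.+1%:R * dens g S.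
Proof.
move=> Sn gn; rewrite /dens mulr_sumr.
rewrite (exchange_big_dep (fun e : {set V} => e \subset S)) /=; last first.
  by move=> v e _; rewrite subsetD1 => /andP[].
apply: eq_bigr => e eS.
rewrite (eq_big (fun v => v \in S :\: e) (fun=> g e / ('C(n, #|e|))%:R)); last 2 first.
- by move=> v; rewrite subsetD1 eS inE andbC.
- move=> v /andP[vS _]; have -> // : #|S :\ v| = n.
  by apply/eqP; rewrite -eqSS -Sn (cardsD1 v S) vS.
rewrite sumr_const cardsDS // Sn -[LHS]mulr_natl.
have [->|/gn en] := eqVneq (g e) 0; first by rewrite !(mul0r, mulr0).
have c1 : ('C(n, #|e|))%:R != 0 :> F by rewrite pnatr_eq0 -lt0n bin_gt0.
have c2 : ('C(n.+1, #|e|))%:R != 0 :> F by rewrite pnatr_eq0 -lt0n bin_gt0 ltnW.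
rewrite [LHS]mulrCA [RHS]mulrCA; congr (_ * _).
apply/eqP; rewrite eqr_div // -!natrM; apply/eqP; congr (_%:R).
by rewrite [RHS](mul_bin_down n.+1 #|e|).
Qed.

(* Deleting a random vertex preserves the expected density, even for weights
   of arbitrary sign. *)
Lemma dens_averaging (F : realType) (V : finType) (g : {set V} -> F) (t : nat)
    (S : {set V}) :
  (forall e, g e != 0 -> (#|e| <= t)%N) -> (t <= #|S|)%N ->
  exists S' : {set V}, [/\ S' \subset S, #|S'| = t & dens g S <= dens g S'].
Proof.
move=> gt /subnKC; move: (#|S| - t)%N => d; elim: d S => [|d IH] S.
  by rewrite addn0 => tS; exists S.
rewrite addnS => Sd; have {}Sd := esym Sd.
have [v vS le_v] : exists2 v, v \in S & dens g S <= dens g (S :\ v).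
  apply: contrapT => /forall2NP no.
  have : \sum_(v in S) dens g (S :\ v) < \sum_(v in S) dens g S.
    apply: ltr_sum => [|v vS].
      by have : (0 < #|S|)%N by [rewrite Sd]; rewrite card_gt0 => /set0Pn[x xS];
        apply/hasP; exists x; rewrite // mem_index_enum.
    by rewrite ltNge; apply/negP; case: (no v).
  rewrite (sum_dens_setD1 Sd) ?sumr_const ?Sd -?[dens g S *+ _]mulr_natl ?ltxx //.
  by move=> e /gt /leq_trans; apply; rewrite leq_addr.
have [|S' [S'v S't le_S']] := IH (S :\ v).
  by apply/eqP; rewrite -eqSS -Sd (cardsD1 v S) vS.
exists S'; split=> //; first by exact: (fintype.subset_trans S'v (finset.subsetDl _ _)).
exact: le_trans le_v le_S'.
Qed.

(** * Hypergraph densities as weighted densities *)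

Definition edge_wt (F : realType) (G : hypergraph) (e : {set vert G}) : F :=
  (e \in edges G)%:R.

Lemma hnE (F : realType) (G : hypergraph) :
  hn F G = dens (@edge_wt F G) [set: vert G]%SET.
Proof.
rewrite /hn /dens big_mkcond [RHS](eq_bigl xpredT) /=; last first.
  by move=> e; rewrite finset.subsetT.
by apply: eq_bigr => e _; rewrite /edge_wt cardsT; case: ifP; rewrite (mul1r, mul0r).
Qed.

Lemma hn_embedding (F : realType) (G K : hypergraph) (f : vert G -> vert K) :
  injective f -> (forall e : {set vert G}, (f @: e \in edges K) = (e \in edges G)) ->
  hn F G = dens (@edge_wt F K) (f @: [set: vert G]%SET).
Proof.
by move=> f_inj fE; rewrite hnE dens_imset //; apply: eq_dens => e; rewrite /edge_wt fE.
Qed.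

Lemma imset_val_setT (V : finType) (S : {set V}) :
  val @: [set: {x : V | x \in S}]%SET = S.
Proof.
apply/setP => x; apply/imsetP/idP => [[y _ ->]|xS]; first exact: (valP y).
by exists (Sub x xS); rewrite ?SubK.
Qed.

Lemma hn_induced (F : realType) (G : hypergraph) (S : {set vert G}) :
  hn F (induced_subgraph S) = dens (@edge_wt F G) S.
Proof.
rewrite -[in RHS](imset_val_setT S).
apply: (@hn_embedding F (induced_subgraph S) G val) => [|e].
  exact: val_inj.
by rewrite inE.
Qed.

Lemma hn_subgraph (F : realType) (H G : hypergraph) (f : vert H -> vert G) :
  injective f -> (forall e : {set vert H}, e \in edges H -> f @: e \in edges G) ->
  hn F H <= dens (@edge_wt F G) (f @: [set: vert H]%SET).
Proof.
move=> f_inj fE; rewrite hnE dens_imset //; apply: le_dens => e.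
by rewrite /edge_wt; case: (boolP (e \in edges H)) => [/fE ->|_] //; rewrite ler0n.
Qed.


Lemma card_induced (G : hypergraph) (S : {set vert G}) :
  #|vert (induced_subgraph S)| = #|S|.
Proof. by rewrite /= card_sig; apply: eq_card => x; rewrite inE. Qed.

Lemma edge_wt_supp (F : realType) (G : hypergraph) (k : nat) :
  (forall e, e \in edges G -> (#|e| <= k)%N) ->
  forall e, @edge_wt F G e != 0 -> (#|e| <= k)%N.
Proof.
by move=> Gk e; rewrite /edge_wt; case: (boolP (e \in _)) => [/Gk|]; rewrite ?eqxx.
Qed.

(** * Pigeonhole and boxes in dense sets of tuples *)

Lemma subset_of_card (T : finType) (A : {set T}) (m : nat) :
  (m <= #|A|)%N -> exists2 B : {set T}, B \subset A & #|B| = m.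
Proof.
move=> mA; exists [set x in take m (enum A)]%SET.
  by apply/fintype.subsetP => x; rewrite inE => /mem_take; rewrite mem_enum.
rewrite cardsE (card_uniqP _) ?take_uniq ?enum_uniq //.
by rewrite size_takel // -cardE.
Qed.

Lemma fiber_pigeonhole (T I : finType) (h : T -> I) (X : {set T}) (B : {set I}) :
  (0 < #|X|)%N -> {in X, forall t, h t \in B} ->
  exists2 i, i \in B & (#|X| <= #|B| * #|[set t in X | h t == i]%SET|)%N.
Proof.
move=> X0 hB; apply: contrapT => /forall2NP no.
have B0 : (0 < #|B|)%N.
  by case/card_gt0P: X0 => t /hB hB'; apply/card_gt0P; exists (h t).
have sumX : (\sum_(i in B) #|[set t in X | h t == i]%SET| = #|X|)%N.
  rewrite -sum1_card (partition_big h (fun i => i \in B)) //=.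
  apply: eq_bigr => i _; rewrite -sum1_card; apply: eq_bigl => t.
  by rewrite inE.
have : (\sum_(i in B) (1 + #|B| * #|[set t in X | h t == i]%SET|) <=
        \sum_(i in B) #|X|)%N.
  apply: leq_sum => i iB; case: (no i) => // /negP.
  by rewrite -ltnNge.
by rewrite big_split /= -big_distrr /= sumX !sum_nat_const muln1 -{2}[(#|B| * _)%N]add0n
  leq_add2r leqNgt B0.
Qed.

Lemma sum_card_indicator (F : realType) (T : finType) (A : {set T}) :
  \sum_t (t \in A)%:R = #|A|%:R :> F.
Proof.
by rewrite -natr_sum -sum1_card [in RHS]big_mkcond.
Qed.

(** Among [m] elements of [V] of high degree, double counting leaves a fraction [d / 4] of [T] with
    at least [q] neighbours; their traces on the [m] elements take at most [2 ^ m] values, so the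
    most popular trace loses only this factor. As [m] depends on [q] and [d] alone, so does [d']. *)
Lemma common_neighbourhood (F : realType) (q : nat) (d : F) : 0 < d ->
  exists2 d' : F, 0 < d' & exists N0 : nat,
    forall (V T : finType) (r : V -> T -> bool), (0 < #|T|)%N -> (N0 <= #|V|)%N ->
    d * #|V|%:R * #|T|%:R <= \sum_v #|[set t | r v t]%SET|%:R ->
    exists2 A : {set V}, #|A| = q &
      d' * #|T|%:R <= #|[set t | [forall v in A, r v t]]%SET|%:R.
Proof.
(* With [4 q < d m], the elements of [T] with fewer than [q] neighbours account for at most half of
   the [d / 2 * m * |T|] incidences. *)
move=> d0; pose m := (Num.bound (4 * q%:R / d)).
have m_gt : 4 * q%:R < d * m%:R.
  have := @archi_boundP F (4 * q%:R / d); rewrite -/m ltr_pdivrMr // mulrC.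
  rewrite [_ * d]mulrC.
  by apply; rewrite !mulr_ge0 // invr_ge0 ltW.
have m0 : 0 < m%:R :> F.
  by rewrite -(pmulr_rgt0 _ d0); apply: le_lt_trans m_gt; rewrite mulr_ge0.
exists (d / 4 / (2 ^ m)%:R); first by rewrite !divr_gt0 // ltr0n expn_gt0.
exists (Num.bound (2 * m%:R / d)) => V T r T0 VN sumr_ge.
have {VN} V_gt : 2 * m%:R <= d * #|V|%:R.
  rewrite mulrC [leRHS]mulrC -ler_pdivrMr //; apply: ltW.
  apply: lt_le_trans (_ : (Num.bound (2 * m%:R / d))%:R <= _); last by rewrite ler_nat.
  rewrite [_ * 2]mulrC; apply: archi_boundP; rewrite !mulr_ge0 // invr_ge0 ltW //.
have {}T0 : 0 < #|T|%:R :> F by rewrite ltr0n.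
pose deg v : F := #|[set t | r v t]%SET|%:R.
pose good := [set v | d / 2 * #|T|%:R <= deg v]%SET.
have deg_le v : deg v <= #|T|%:R by rewrite /deg ler_nat max_card.
have good_ge : (m <= #|good|)%N.
  rewrite -(ler_nat F).
  suff : d / 2 * #|V|%:R <= #|good|%:R by lra.
  rewrite -(ler_pM2r T0).
  suff : \sum_v deg v <= d / 2 * #|V|%:R * #|T|%:R + #|good|%:R * #|T|%:R.
    by move: sumr_ge; rewrite -/(deg _); lra.
  rewrite -sum_card_indicator mulr_suml.
  rewrite (_ : d / 2 * #|V|%:R * #|T|%:R = \sum_(v : V) d / 2 * #|T|%:R); last first.
    by rewrite sumr_const -mulr_natl; ring.
  rewrite -big_split; apply: ler_sum => v _ /=; rewrite inE.
  case: (leP (d / 2 * #|T|%:R) (deg v)) => [_|/ltW]; last by rewrite mulr0n mul0r addr0.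
  by rewrite mulr1n mul1r; apply: le_trans (deg_le v) _; rewrite lerDr !mulr_ge0 // ltW.
have [W Wgood Wm] := subset_of_card good_ge.
pose D t := [set v in W | r v t]%SET.
pose goodT := [set t | (q <= #|D t|)%N]%SET.
have goodT_ge : d / 4 * #|T|%:R <= #|goodT|%:R.
  have : d / 2 * m%:R * #|T|%:R <= \sum_t #|D t|%:R.
    rewrite (_ : \sum_t #|D t|%:R = \sum_(v in W) deg v).
      rewrite (_ : d / 2 * m%:R * #|T|%:R = \sum_(v in W) d / 2 * #|T|%:R).
        apply: ler_sum => v /(fintype.subsetP Wgood); by rewrite inE.
      by rewrite sumr_const Wm -mulr_natl; ring.
    under eq_bigr do rewrite -sum_card_indicator.
    rewrite exchange_big /= [RHS]big_mkcond /=; apply: eq_bigr => v _.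
    case: ifP => vW; last by apply: big1 => t _; rewrite inE vW.
    by rewrite /deg -sum_card_indicator; apply: eq_bigr => t _; rewrite !inE vW.
  have : \sum_t #|D t|%:R <= q%:R * #|T|%:R + m%:R * #|goodT|%:R :> F.
    rewrite -sum_card_indicator mulr_sumr.
    rewrite (_ : q%:R * #|T|%:R = \sum_(t : T) q%:R); last first.
      by rewrite sumr_const mulr_natr.
    rewrite -big_split; apply: ler_sum => t _ /=; rewrite inE.
    case: (leqP q #|D t|) => [_|/ltnW le_q]; last by rewrite mulr0n mulr0 addr0 ler_nat.
    rewrite mulr1n mulr1; apply: (@le_trans _ _ m%:R); last by rewrite lerDr.
    rewrite ler_nat -Wm subset_leq_card //; apply/fintype.subsetP => v.
    by rewrite inE => /andP[].
  have q_le : q%:R * #|T|%:R <= d / 4 * m%:R * #|T|%:R by rewrite ler_pM2r //; lra.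
  move=> h1 h2; rewrite -(ler_pM2l m0); lra.
have [||S SW S_ge] := @fiber_pigeonhole T _ D goodT (powerset W).
- by rewrite -(ltr0n F); apply: lt_le_trans goodT_ge; rewrite !mulr_gt0.
- by move=> t _; rewrite powersetE; apply/fintype.subsetP => v; rewrite inE => /andP[].
rewrite card_powerset Wm in S_ge.
have S_ge' : d / 4 * #|T|%:R <= (2 ^ m)%:R * #|[set t in goodT | D t == S]%SET|%:R.
  by apply: le_trans goodT_ge _; rewrite -natrM ler_nat.
have [|A AS Aq] := @subset_of_card _ S q.
  have : (0 < #|[set t in goodT | D t == S]%SET|)%N.
    have : 0 < (2 ^ m)%:R * #|[set t in goodT | D t == S]%SET|%:R :> F.
      by apply: lt_le_trans S_ge'; rewrite !mulr_gt0.
    by rewrite -natrM ltr0n muln_gt0 => /andP[].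
  by case/card_gt0P => t; rewrite !inE => /andP[+ /eqP <-].
exists A => //.
apply: (@le_trans _ _ #|[set t in goodT | D t == S]%SET|%:R).
  by rewrite mulrAC ler_pdivrMr ?ltr0n ?expn_gt0 // [leRHS]mulrC.
rewrite ler_nat subset_leq_card //; apply/fintype.subsetP => t.
rewrite !inE => /andP[_ /eqP DS]; apply/forall_inP => v /(fintype.subsetP AS).
by rewrite -DS inE => /andP[].
Qed.

Lemma card_tuple_cons (V : finType) (s : nat) (X : {set s.+1.-tuple V}) :
  #|X| = (\sum_v #|[set t : s.-tuple V | [tuple of v :: t] \in X]%SET|)%N.
Proof.
under eq_bigr do rewrite -sum1_card.
rewrite pair_big_dep /= -sum1_card.
rewrite (reindex (fun p : V * s.-tuple V => [tuple of p.1 :: p.2])) /=.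
  by apply: eq_bigl => -[v t]; rewrite !inE.
exists (fun t : s.+1.-tuple V => (thead t, [tuple of behead t])) => [[v t] _|t _] /=.
  by congr pair; apply: val_inj.
by rewrite [RHS]tuple_eta; apply: val_inj.
Qed.

(* Erdos's theorem on complete s-partite subhypergraphs, for s-tuples. *)
Lemma dense_tuples_contain_box (F : realType) (q s : nat) (d : F) : 0 < d ->
  exists N0 : nat, forall (V : finType) (X : {set s.-tuple V}), (N0 <= #|V|)%N ->
    d * #|V|%:R ^+ s <= #|X|%:R ->
    exists2 A : 'I_s -> {set V}, forall i, #|A i| = q &
      forall t : s.-tuple V, (forall i, tnth t i \in A i) -> t \in X.
Proof.
elim: s d => [|s IH] d d0.
  exists 0%N => V X _; rewrite expr0 mulr1 => dX.
  have : (0 < #|X|)%N by rewrite -(ltr0n F); apply: lt_le_trans dX.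
  case/card_gt0P => t tX; exists (fun=> finset.set0) => [[]//|t' _].
  by rewrite (tuple0 t') -(tuple0 t).
(* The head is split off: some [q] heads share a set of tails of density [d'], to which the
   induction hypothesis applies. *)
have [d' d'0 [N1 common]] := common_neighbourhood q d0.
have [N2 box] := IH d' d'0.
(* The bound 1 makes the set of all tails nonempty. *)
exists (maxn 1 (maxn N1 N2)) => V X; rewrite !geq_max => /and3P[V0 VN1 VN2] dX.
have [||A0 A0q A0_ge] :=
    common V (s.-tuple V) (fun v t => [tuple of v :: t] \in X) _ VN1.
- by rewrite card_tuple expn_gt0 V0.
- by rewrite card_tuple natrX -mulrA -exprS -natr_sum -card_tuple_cons.
rewrite card_tuple natrX in A0_ge.
have [A Aq A_box] := box V _ VN2 A0_ge.
exists (fun i => if unlift ord0 i is Some j then A j else A0) => [i|t tA].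
  by case: unliftP.
have : [tuple of behead t] \in [set t0 : s.-tuple V |
    [forall v in A0, [tuple of v :: t0] \in X]]%SET.
  apply: A_box => i; have := tA (lift ord0 i); rewrite liftK.
  suff -> : tnth [tuple of behead t] i = tnth t (lift ord0 i) by [].
  by rewrite tnth_behead; congr tnth; apply: val_inj; rewrite /= inordK // ltnS.
rewrite inE => /forall_inP /(_ (thead t)); rewrite -tuple_eta; apply.
by have := tA ord0; rewrite unlift_none.
Qed.

(** * Blow-ups *)

Lemma ffact_le_exp (n r : nat) : (n ^_ r <= n ^ r)%N.
Proof.
elim: r => [|r IH]; first by rewrite ffactn0.
by rewrite ffactnSr expnSr leq_mul // leq_subr.
Qed.

Lemma exp_le_ffact (n r : nat) : (r.*2 <= n)%N -> (n ^ r <= 2 ^ r * n ^_ r)%N.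
Proof.
elim: r => [|r IH] rn; first by rewrite ffactn0.
have /IH {}IH : (r.*2 <= n)%N by lia.
rewrite ffactnSr !expnSr mulnACA leq_mul //; lia.
Qed.

Lemma ffact_ge (F : realType) (s r : nat) : (0 < s)%N -> (r <= s)%N ->
  (1 - r%:R ^+ 2 / s%:R) * s%:R ^+ r <= (s ^_ r)%:R :> F.
Proof.
move=> s0; elim: r => [|r IH] rs.
  by rewrite ffactn0 expr0n mul0r subr0 expr0 mulr1.
have {}IH := IH (ltnW rs).
have s0F : 0 < s%:R :> F by rewrite ltr0n.
rewrite ffactnSr natrM natrB ?(ltnW rs) //.
apply: (@le_trans _ _ ((1 - r%:R ^+ 2 / s%:R) * s%:R ^+ r * (s%:R - r%:R))); last first.
  by rewrite ler_wpM2r // subr_ge0 ler_nat ltnW.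
rewrite [s%:R ^+ r.+1]exprSr [leRHS]mulrAC mulrCA mulrC.
rewrite ler_wpM2r ?exprn_ge0 // -natr1.
have -> : (1 - (r%:R + 1) ^+ 2 / s%:R) * s%:R = s%:R - (r%:R + 1) ^+ 2 :> F.
  by field; rewrite gt_eqF.
have -> : (1 - r%:R ^+ 2 / s%:R) * (s%:R - r%:R) =
    s%:R - r%:R - r%:R ^+ 2 + r%:R ^+ 2 / s%:R * r%:R :> F.
  by field; rewrite gt_eqF.
have h2 : 0 <= r%:R ^+ 2 / s%:R * r%:R :> F by rewrite !mulr_ge0 ?invr_ge0.
have h3 : 0 <= r%:R :> F by [].
lra.
Qed.

(** An [r]-edge on [s] vertices becomes [q ^ r] edges on [s * q] vertices. All reduces to the bound
    of [ffact_ge] on [s ^_ r], so the loss is uniform in [q] and in [r <= k]. *)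
Lemma bin_blowup (F : realType) (r s q k : nat) :
  (0 < s)%N -> (0 < q)%N -> (r <= k)%N -> (k <= s)%N ->
  (1 - k%:R ^+ 2 / s%:R) / ('C(s, r))%:R <= (q ^ r)%:R / ('C(s * q, r))%:R :> F.
Proof.
move=> s0 q0 rk ks; have rs := leq_trans rk ks.
have s0F : 0 < s%:R :> F by rewrite ltr0n.
have rsq : (r <= s * q)%N by rewrite (leq_trans rs) // leq_pmulr.
set c : F := 1 - _.
rewrite ler_pdivrMr ?ltr0n ?bin_gt0 // [leRHS]mulrAC ler_pdivlMr ?ltr0n ?bin_gt0 //.
have f0 : 0 < (r`!)%:R :> F by rewrite ltr0n fact_gt0.
rewrite -(ler_pM2r f0) -!mulrA -!natrM !bin_ffact.
have [neg|pos] := leP c 0.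
  by apply: (@le_trans _ _ 0) => //; rewrite mulr_le0_ge0.
apply: (@le_trans _ _ (c * ((s * q) ^ r)%:R)).
  by rewrite ler_pM2l // ler_nat ffact_le_exp.
rewrite expnMn !natrM mulrA [leRHS]mulrC ler_wpM2r //.
apply: le_trans (ffact_ge F s0 rs); rewrite natrX ler_wpM2r ?exprn_ge0 //.
by rewrite lerB // ler_wpM2r ?invr_ge0 // lerXn2r ?nnegrE // ler_nat.
Qed.

Lemma card_pfamily_const (I T : finType) (y : T) (f : {set I}) (A : I -> {set T})
  (q : nat) : (forall i, #|A i| = q) ->
  #|pfamily y (mem f) (fun i => mem (A i))| = (q ^ #|f|)%N.
Proof.
move=> Aq; rewrite card_pfamily cardE /image_mem (eq_map (g := fun=> q)) //.
by elim: (enum _) => //= x l ->; rewrite expnS.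
Qed.

(** A point common to two parts could be chosen in both, giving a transversal that is not
    injective. *)
Lemma box_disjoint (s : nat) (V : finType) (A : 'I_s -> {set V}) :
  (forall i, (0 < #|A i|)%N) ->
  (forall phi : 'I_s -> V, (forall i, phi i \in A i) -> injective phi) ->
  forall i j x, x \in A i -> x \in A j -> i = j.
Proof.
move=> A0 A_inj i j x xi xj.
have /choice[psi psiA] : forall k, exists y, y \in A k.
  by move=> k; apply/card_gt0P.
pose phi k := if (k == i) || (k == j) then x else psi k.
apply: (A_inj phi); last by rewrite /phi !eqxx orbT.
by move=> k; rewrite /phi; case: eqP => [->|_] //=; case: eqP => [->|].
Qed.

Lemma card_bigcup_box (s q : nat) (V : finType) (A : 'I_s -> {set V}) :
  (forall i, #|A i| = q) -> (forall i j x, x \in A i -> x \in A j -> i = j) ->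
  #|\bigcup_i A i| = (s * q)%N.
Proof.
move=> Aq A_disj; rewrite -sum1_card partition_disjoint_bigcup /=.
  under eq_bigr do rewrite sum1_card Aq.
  by rewrite sum_nat_const card_ord.
move=> i j ij; rewrite -setI_eq0; apply/eqP/setP => x; rewrite !inE.
by apply/negP => /andP[xi xj]; move: ij; rewrite (A_disj _ _ _ xi xj) eqxx.
Qed.

(* The subgraph of [G] spanned by the box contains the blow-up of [H]. *)
Lemma dens_blowup (F : realType) (G : hypergraph) (s q k : nat)
    (A : 'I_s -> {set vert G}) (H : {set {set 'I_s}}) :
  (0 < s)%N -> (0 < q)%N -> (k <= s)%N -> (forall i, #|A i| = q) ->
  (forall f, f \in H -> (#|f| <= k)%N) ->
  (forall phi : 'I_s -> vert G, (forall i, phi i \in A i) ->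
    injective phi /\ forall f, f \in H -> phi @: f \in edges G) ->
  (1 - k%:R ^+ 2 / s%:R) * hn F (Hypergraph H) <=
  dens (@edge_wt F G) (\bigcup_i A i).
Proof.
move=> s0 q0 ks Aq Hk box.
have A0 i : (0 < #|A i|)%N by rewrite Aq.
have A_disj := box_disjoint A0 (fun phi h => (box phi h).1).
have cardU := card_bigcup_box Aq A_disj.
have /choice[psi psiA] : forall i, exists y, y \in A i.
  by move=> i; apply/card_gt0P.
pose x0 := psi (Ordinal s0).
(* The edges are grouped by the set [p e] of parts that they meet; the group of [f] is compared with
   the single term of [f] in the density of [H]. *)
pose p (e : {set vert G}) := [set i | [exists x in e, x \in A i]]%SET.
rewrite hnE /dens (partition_big p xpredT) //= mulr_sumr.
rewrite [leLHS](eq_bigl xpredT) /=; last by move=> e; rewrite finset.subsetT.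
apply: ler_sum => f _; rewrite /edge_wt /= cardsT card_ord cardU.
case: (boolP (f \in H)) => [fH|_]; last first.
  by rewrite mul0r mulr0 sumr_ge0 // => e _; rewrite mulr_ge0 ?invr_ge0.
rewrite mul1r.
(* Choices over [f] only, with the default [x0] elsewhere, so that each partial transversal is
   counted once. *)
pose fam := pfamily x0 (mem f) (fun i => mem (A i)).
have famP (phi : {ffun 'I_s -> vert G}) : phi \in fam ->
    (forall i, i \in f -> phi i \in A i) /\ (forall i, i \notin f -> phi i = x0).
  move=> /pfamilyP[supp phiA]; split=> [i|i fi]; first exact: phiA.
  by apply/eqP; apply: contraR fi => ne; apply: (fintype.subsetP supp).
pose Tr := [set phi @: f | phi : {ffun 'I_s -> vert G} in fam]%SET.
have cardTr : #|Tr| = (q ^ #|f|)%N.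
  rewrite card_in_imset ?(card_pfamily_const _ _ Aq) // => phi1 phi2 /famP[in1 out1].
  move=> /famP[in2 out2] eq12; apply/ffunP => i.
  have [fi|fi] := boolP (i \in f); last by rewrite out1 // out2.
  have : phi1 i \in phi2 @: f by rewrite -eq12 imset_f.
  case/imsetP => j fj eqj.
  have ij : i = j by apply: (A_disj _ _ (phi1 i)); rewrite ?in1 // eqj in2.
  by rewrite eqj ij.
have TrP e : e \in Tr ->
    [/\ e \subset \bigcup_i A i, e \in edges G, p e = f & #|e| = #|f|].
  case/imsetP => phi /famP[phi_in _] ->.
  (* [box] speaks of choices in all parts; [psi] completes the partial one. *)
  pose phi' i := if i \in f then phi i else psi i.
  have phi'A i : phi' i \in A i by rewrite /phi'; case: ifP => // /phi_in.
  have -> : phi @: f = phi' @: f by apply: eq_in_imset => i; rewrite /phi' => ->.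
  have [phi'_inj phi'E] := box _ phi'A; split.
  - apply/fintype.subsetP => _ /imsetP[i _ ->]; apply/finset.bigcupP; by exists i.
  - exact: phi'E.
  - apply/setP => i; rewrite inE; apply/exists_inP/idP => [[_ /imsetP[j fj ->]]|fi].
      by move/(A_disj _ _ _ (phi'A j)) => <-.
    by exists (phi' i); rewrite ?imset_f.
  - by rewrite card_imset.
apply: le_trans (bin_blowup F s0 q0 (Hk _ fH) ks) _.
rewrite -cardTr mulr_natl -sumr_const big_mkcond [leRHS]big_mkcond /=.
apply: ler_sum => e _; case: (boolP (e \in Tr)) => [/TrP[-> -> -> ->]|_].
  by rewrite eqxx mul1r.
by case: ifP => // _; rewrite mulr_ge0 ?invr_ge0.
Qed.

(** * Supersaturation of dense sets *)

Definition dense_sets (F : realType) (G : hypergraph) (s : nat) (x : F) :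
    {set {set vert G}} :=
  [set e : {set vert G} | (#|e| == s) && (x <= dens (@edge_wt F G) e)]%SET.

(** Enumerations of the dense sets, the form that the box theorem takes; [uniq] gives the underlying
    set exactly [s] elements. *)
Definition dense_tuples (F : realType) (G : hypergraph) (s : nat) (x : F) :
    {set s.-tuple (vert G)} :=
  [set t : s.-tuple (vert G) |
    uniq t && (x <= dens (@edge_wt F G) [set v in t])]%SET.

Lemma card_dense_sets_le_tuples (F : realType) (G : hypergraph) (s : nat) (x : F) :
  (#|dense_sets G s x| <= #|dense_tuples G s x|)%N.
Proof.
apply: leq_trans (leq_imset_card (fun t : s.-tuple (vert G) => [set v in t]%SET) _).
apply: subset_leq_card; apply/fintype.subsetP => e; rewrite inE => /andP[/eqP es xe].
have sz : size (enum e) == s by rewrite -cardE es.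
have eE : [set v in Tuple sz]%SET = e by apply/setP => v; rewrite inE mem_enum.
by apply/imsetP; exists (Tuple sz); rewrite ?eE // inE eE enum_uniq.
Qed.

Lemma dens_dense_sets (F : realType) (G : hypergraph) (s : nat) (x : F)
    (S : {set vert G}) :
  dens (fun e => (e \in dense_sets G s x)%:R : F) S =
  #|[set e in dense_sets G s x | e \subset S]%SET|%:R / ('C(#|S|, s))%:R :> F.
Proof.
rewrite /dens -sum_card_indicator mulr_suml big_mkcond /=; apply: eq_bigr => e _.
rewrite !inE; case: (e \subset S); rewrite ?andbT ?andbF ?mul0r //.
by case: eqP => [->//|]; rewrite /= !mul0r.
Qed.

Lemma hn_pullback (F : realType) (G : hypergraph) (s : nat) (phi : 'I_s -> vert G) :
  injective phi ->
  hn F (Hypergraph [set f : {set 'I_s} | phi @: f \in edges G]%SET) =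
  dens (@edge_wt F G) (phi @: [set: 'I_s]%SET).
Proof.
by move=> phi_inj; apply: (@hn_embedding F (Hypergraph _) G phi) => // e; rewrite inE.
Qed.

(* Supersaturation: a positive proportion of denser [s]-sets forces a box of
   isomorphic ones, hence a blow-up of a denser graph on [s] vertices. *)
Lemma dense_sets_supersaturation (F : realType) (k : nat) (a eps : F) :
  0 <= a -> 0 < eps ->
  exists s0 : nat, forall s t : nat, (s0 <= s)%N -> (k <= t)%N ->
  forall eta : F, 0 < eta ->
  exists N0 : nat, forall G : hypergraph, (N0 <= #|vert G|)%N ->
    (forall e, e \in edges G -> (#|e| <= k)%N) ->
    (forall S : {set vert G}, #|S| = t -> dens (@edge_wt F G) S < a + eps / 2) ->
    dens (fun e => (e \in dense_sets G s (a + eps))%:R : F) [set: vert G]%SET <= eta.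
Proof.
move=> a0 eps0.
(* From this size on [k ^ 2 / s * (a + eps) <= eps / 2]: the blow-up loses at most half of the
   excess [eps]. *)
exists (maxn (maxn 1 k) (Num.bound (2 * k%:R ^+ 2 * (a + eps) / eps))) => s t.
rewrite !geq_max => /andP[/andP[s0 ks] s_large] kt eta eta0.
have ae0 : 0 <= a + eps by rewrite addr_ge0 // ltW.
have {}s_large : 2 * k%:R ^+ 2 * (a + eps) <= s%:R * eps.
  rewrite -ler_pdivrMr //; apply: ltW.
  apply: lt_le_trans (_ : (Num.bound (2 * k%:R ^+ 2 * (a + eps) / eps))%:R <= _).
    by apply: archi_boundP; rewrite !mulr_ge0 // ?exprn_ge0 // invr_ge0 ltW.
  by rewrite ler_nat.
have s0F : 0 < s%:R :> F by rewrite ltr0n.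
pose K := #|[set: {set {set 'I_s}}]%SET|.
have K0 : (0 < K)%N by apply/card_gt0P; exists finset.set0; rewrite inE.
(* For [2 s <= N], [N ^ s] is at most [c] times [C(N, s)], so a proportion [eta] of sets gives a
   proportion [eta / c] of tuples; the pigeonhole over the [K] graphs on ['I_s] then costs a factor
   [K]. *)
pose c : F := (2 ^ s * s`!)%:R.
have c0 : 0 < c by rewrite ltr0n muln_gt0 expn_gt0 fact_gt0.
have K0F : 0 < K%:R :> F by rewrite ltr0n.
have d0 : 0 < eta / c / K%:R by rewrite !divr_gt0.
(* Parts of size [t.+1] are nonempty even for [t = 0], and together they have at least [t]
   vertices. *)
have [N1 box] := dense_tuples_contain_box t.+1 s d0.
exists (maxn s.*2 N1) => G; rewrite geq_max => /andP[Gs GN1] Gk Gt.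
rewrite leNgt; apply/negP; rewrite dens_dense_sets cardsT.
set Bad := [set e in _ | _]%SET => many.
set N := #|vert G| in Gs GN1 many.
have sN : (s <= N)%N by apply: leq_trans Gs; rewrite -addnn leq_addr.
have bin0 : 0 < ('C(N, s))%:R :> F by rewrite ltr0n bin_gt0.
rewrite ltr_pdivlMr // in many.
pose X := dense_tuples G s (a + eps).
have X_ge : eta / c * N%:R ^+ s <= #|X|%:R.
  apply: (@le_trans _ _ (eta * ('C(N, s))%:R)).
    rewrite -mulrA ler_pM2l // mulrC ler_pdivrMr // -natrX -natrM ler_nat.
    by rewrite mulnCA bin_ffact exp_le_ffact.
  apply: le_trans (ltW many) _; rewrite ler_nat.
  apply: leq_trans (card_dense_sets_le_tuples _ _ _).
  by apply: subset_leq_card; apply/fintype.subsetP => e; rewrite inE => /andP[].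
(* Tuples are coloured by the graph they induce on their positions; one colour class contains a box,
   all of whose transversals then induce the same [H]. *)
pose h (t : s.-tuple (vert G)) := [set f : {set 'I_s} | tnth t @: f \in edges G]%SET.
have [||H _ H_ge] := @fiber_pigeonhole _ _ h X [set: {set {set 'I_s}}]%SET.
- rewrite -(ltr0n F); apply: lt_le_trans X_ge.
  by rewrite mulr_gt0 ?divr_gt0 ?exprn_gt0 // ltr0n (leq_trans s0).
- by move=> u _; rewrite inE.
have [|A Aq A_box] := box _ [set u in X | h u == H]%SET GN1.
  rewrite mulrAC ler_pdivrMr //; apply: le_trans X_ge _.
  by rewrite -natrM ler_nat mulnC.
have boxP (phi : 'I_s -> vert G) : (forall i, phi i \in A i) ->
    [/\ injective phi, [set f : {set 'I_s} | phi @: f \in edges G]%SET = H &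
        a + eps <= hn F (Hypergraph H)].
  move=> phiA; have /A_box : forall i, tnth [tuple phi i | i < s] i \in A i.
    by move=> i; rewrite tnth_mktuple.
  rewrite !inE => /andP[/andP[uniq_phi phi_ge] /eqP hH].
  have phiE : tnth [tuple phi i | i < s] =1 phi by move=> i; rewrite tnth_mktuple.
  have phi_inj : injective phi.
    by move=> i j; rewrite -!phiE; apply/tuple_uniqP.
  have phiH : [set f : {set 'I_s} | phi @: f \in edges G]%SET = H.
    by rewrite -hH; apply/setP => f; rewrite !inE (eq_imset _ phiE).
  split=> //; rewrite -phiH hn_pullback //; apply: le_trans phi_ge _.
  rewrite le_eqVlt; apply/orP; left; apply/eqP; congr dens.
  apply/setP => v; rewrite inE; apply/idP/imsetP => [/tnthP[i ->]|[i _ ->]].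
    by exists i; rewrite ?tnth_mktuple.
  by apply/tnthP; exists i; rewrite tnth_mktuple.
have /choice[psi psiA] : forall i, exists y, y \in A i.
  by move=> i; apply/card_gt0P; rewrite Aq.
have [psi_inj psiH H_dense] := boxP _ psiA.
have U_ge : (1 - k%:R ^+ 2 / s%:R) * hn F (Hypergraph H) <=
    dens (@edge_wt F G) (\bigcup_i A i).
  apply: (@dens_blowup F G s t.+1 k A H) => // [f|phi /boxP[phi_inj phiH _]].
    by rewrite -psiH inE => /Gk; rewrite card_imset.
  by split=> // f; rewrite -phiH inE.
have cardU : #|\bigcup_i A i| = (s * t.+1)%N.
  apply: card_bigcup_box => //; apply: box_disjoint => [i|phi /boxP[]//].
  by rewrite Aq.
have [||S [_ St S_ge]] := @dens_averaging F _ (@edge_wt F G) t (\bigcup_i A i).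
- by apply: edge_wt_supp => e /Gk /leq_trans; apply.
- by rewrite cardU (leq_trans (leqnSn t)) // leq_pmull.
have := Gt S St; rewrite ltNge => /negP; apply.
apply: le_trans S_ge; apply: le_trans U_ge.
have small : k%:R ^+ 2 / s%:R * (a + eps) <= eps / 2.
  by rewrite mulrAC ler_pdivrMr //; lra.
(* The nonpositive case is contradictory: [small] would give [a + eps / 2 <= 0]. *)
have [neg|pos] := leP (1 - k%:R ^+ 2 / s%:R : F) 0.
  have : (1 - k%:R ^+ 2 / s%:R) * (a + eps) <= 0 by rewrite mulr_le0_ge0.
  rewrite mulrBl mul1r; lra.
apply: (@le_trans _ _ ((1 - k%:R ^+ 2 / s%:R) * (a + eps))); last by rewrite ler_pM2l.
rewrite mulrBl mul1r; lra.
Qed.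

(** * Locally sparse graphs of large density *)

Lemma dens_edge_wt_le (F : realType) (G : hypergraph) (S : {set vert G}) :
  dens (@edge_wt F G) S <= (2 ^ #|S|)%:R.
Proof.
rewrite -card_powerset -sum1_card natr_sum /dens.
rewrite [leRHS](eq_bigl (fun e : {set vert G} => e \subset S)); last first.
  by move=> e; rewrite powersetE.
apply: ler_sum => e eS; have C0 : (0 < 'C(#|S|, #|e|))%N.
  by rewrite bin_gt0 subset_leq_card.
rewrite ler_pdivrMr ?ltr0n // mul1r /edge_wt ler_nat.
by apply: leq_trans C0; case: (e \in _).
Qed.

Lemma Rgraph_edge_card (R : {fset nat}) (G : hypergraph) (e : {set vert G}) :
  is_Rgraph R G -> e \in edges G -> (#|e| <= \max_(r <- R) r)%N.
Proof. by move=> RG /RG eR; apply: leq_bigmax_seq. Qed.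

(** The subgraph induced on a dense [t]-set would be a subgraph as the jump demands, so the absence
    of such subgraphs bounds the density of every [t]-set. *)
Lemma not_strong_jumpP (F : realType) (R : {fset nat}) (a c : F) :
  ~ strong_jump R a -> 0 < c ->
  exists2 t : nat, (\max_(r <- R) r <= t)%N & forall n0 : nat,
    exists G : hypergraph, [/\ (n0 <= #|vert G|)%N, is_Rgraph R G, a - c <= hn F G &
      forall S : {set vert G}, #|S| = t -> dens (@edge_wt F G) S < a + c].
Proof.
move=> nj c0; apply: contrapT => /forall2NP no; apply: nj; exists c => // t kt.
case: (no t) => // /existsNP[n0 n0P]; exists n0 => G Gn0 RG aG.
apply: contrapT => noH; apply: n0P; exists G; split=> // S St.
rewrite ltNge; apply/negP => S_ge; apply: noH; exists (induced_subgraph S).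
split; last by rewrite hn_induced.
  by exists val => [|e]; [exact: val_inj | rewrite inE].
by rewrite card_induced.
Qed.

(* Dense [s j]-sets being rare, a random [M]-set with a penalty for each of them
   beats the average of [hn]; the penalty [C] exceeds any density, so none of
   them survives. *)
Lemma locally_sparse_graphs (F : realType) (R : {fset nat}) (a : F) :
  0 <= a -> ~ strong_jump R a ->
  exists2 s : nat -> nat, forall j, (\max_(r <- R) r <= s j)%N &
  forall i : nat, exists K : hypergraph,
    [/\ is_Rgraph R K, (i <= #|vert K|)%N, a - i.+1%:R^-1 <= hn F K &
     forall j (S : {set vert K}), (j <= i)%N -> #|S| = s j ->
       dens (@edge_wt F K) S < a + j.+1%:R^-1].
Proof.
move=> a0 nj; set k := \max_(r <- R) r.
have pos j : 0 < j.+1%:R^-1 :> F by rewrite invr_gt0 ltr0n.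
have /choice[s0 s0P] := fun j => dense_sets_supersaturation k a0 (pos j).
pose s j := maxn (s0 j) k.
exists s => [j|i]; first by rewrite leq_maxr.
have i0 : 0 < i.+1%:R :> F by rewrite ltr0n.
(* Half of [1 / (i + 1)] covers the deficit of [hn F G] below [a], the other half the penalties;
   moreover [c] is at most half of [1 / (j + 1)] for all [j <= i], as supersaturation asks. *)
pose c : F := i.+1%:R^-1 / 2.
have c0 : 0 < c by rewrite divr_gt0 // invr_gt0.
have [t kt graphs] := not_strong_jumpP nj c0.
pose M := (i + k + \sum_(j < i.+1) s j)%N.
have sM (j : 'I_i.+1) : (s j <= M)%N.
  by rewrite /M (bigD1 j) //= addnCA leq_addr.
(* A surviving bad set would force [a - 1 / (i + 1) + C <= 2 ^ M]; the left side is at least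
   [C - 1], hence the 2. *)
pose C : F := (2 ^ M)%:R + 2.
have C0 : 0 < C by rewrite addr_gt0 // ltr0n expn_gt0.
(* This weight turns the density of bad [s j]-sets in an [M]-set into their number, so that each
   costs a full [C]. *)
pose b j : F := ('C(M, s j))%:R.
have b0 j : 0 <= b j by rewrite ler0n.
(* Chosen so that the [i + 1] average penalties add up to at most [c]; the [+ 1] keeps the
   denominator positive even where [b j] vanishes. *)
pose eta j := c / i.+1%:R / (C * (b j + 1)).
have eta0 j : 0 < eta j by rewrite !divr_gt0 // mulr_gt0 // ltr_wpDl.
have /choice[N NP] := fun j => s0P j (s j) t (leq_maxl _ _) kt (eta j) (eta0 j).
have [G [Gn RG aG Gt]] := graphs (M + \sum_(j < i.+1) N j)%N.
have GM : (M <= #|vert G|)%N by apply: leq_trans Gn; rewrite leq_addr.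
have rare (j : 'I_i.+1) :
    dens (fun e => (e \in dense_sets G (s j) (a + j.+1%:R^-1))%:R : F)
      [set: vert G]%SET <= eta j.
  apply: NP => [|e|S /Gt]; last 2 first.
  - exact: Rgraph_edge_card.
  - move/lt_le_trans; apply; rewrite lerD2l ler_pM2r //.
    by rewrite lef_pV2 ?posrE ?ltr0n // ler_nat.
  by apply: leq_trans Gn; rewrite (bigD1 j) //= addnCA leq_addr.
pose bad (j : 'I_i.+1) (e : {set vert G}) : F :=
  (e \in dense_sets G (s j) (a + j.+1%:R^-1))%:R.
pose g e : F := @edge_wt F G e - C * \sum_(j < i.+1) b j * bad j e.
have densg S : dens g S =
    dens (@edge_wt F G) S - C * \sum_(j < i.+1) b j * dens (bad j) S.
  rewrite /g densB densZ dens_sum; congr (_ - _ * _).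
  by apply: eq_bigr => j _; rewrite densZ.
have g_supp e : g e != 0 -> (#|e| <= M)%N.
  apply: contraR; rewrite -ltnNge => Me; apply/eqP.
  have eE : e \notin edges G.
    apply/negP => /(Rgraph_edge_card RG); apply/negP; rewrite -ltnNge.
    by apply: leq_ltn_trans Me; rewrite /M addnAC leq_addl.
  rewrite /g /edge_wt (negbTE eE) sub0r big1 ?mulr0 ?oppr0 // => j _.
  rewrite /bad inE; case: eqP => [es|_]; last by rewrite mulr0.
  by move: Me; rewrite es ltnNge sM.
have [||S [_ SM S_ge]] := @dens_averaging F _ g M [set: vert G]%SET.
- exact: g_supp.
- by rewrite cardsT.
have loss : C * \sum_(j < i.+1) b j * dens (bad j) [set: vert G]%SET <= c.
  apply: (@le_trans _ _ (\sum_(j < i.+1) c / i.+1%:R)); last first.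
    by rewrite sumr_const card_ord -[leLHS]mulr_natr divfK // gt_eqF.
  rewrite mulr_sumr; apply: ler_sum => j _.
  apply: (@le_trans _ _ (C * (b j + 1) * eta j)); last first.
    by rewrite mulrC divfK // gt_eqF // mulr_gt0 // ltr_wpDl.
  rewrite mulrA; apply: ler_pM.
  + by rewrite mulr_ge0 // ltW.
  + by apply: dens_ge0 => e; rewrite ler0n.
  + by rewrite ler_pM2l // lerDl.
  + exact: rare.
have S_large : a - i.+1%:R^-1 + C * \sum_(j < i.+1) b j * dens (bad j) S <=
    dens (@edge_wt F G) S.
  have -> : i.+1%:R^-1 = c + c by rewrite /c -splitr.
  move: S_ge loss; rewrite !densg -hnE; set L := C * _; set P := C * _.
  clearbody L P c; lra.
have penalty_ge0 (j : 'I_i.+1) : 0 <= b j * dens (bad j) S.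
  by rewrite mulr_ge0 // dens_ge0 // => e; rewrite ler0n.
exists (induced_subgraph S); split.
- by move=> e; rewrite inE => /RG; rewrite card_imset //; exact: val_inj.
- by rewrite card_induced SM /M -addnA leq_addr.
- rewrite hn_induced; apply: le_trans S_large; rewrite lerDl mulr_ge0 ?(ltW C0) //.
  by apply: sumr_ge0 => l _.
move=> j T ji Ts; rewrite ltNge; apply/negP => T_ge.
pose j' : 'I_i.+1 := Ordinal (ji : (j < i.+1)%N).
have vinj : injective (val : {x : vert G | x \in S} -> vert G) by exact: val_inj.
have TS : val @: T \subset S.
  by apply/fintype.subsetP => _ /imsetP[x _ ->]; exact: (valP x).
have T_bad : val @: T \in dense_sets G (s j) (a + j.+1%:R^-1).
  rewrite inE card_imset // Ts eqxx /= dens_imset //.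
  rewrite (eq_dens (g' := @edge_wt F (induced_subgraph S))) // => e.
  by rewrite /edge_wt inE.
have : 1 <= \sum_(j < i.+1) b j * dens (bad j) S.
  rewrite (bigD1 j') //= -[1]addr0; apply: lerD; last by apply: sumr_ge0 => l _.
  have bj : 0 < b j by rewrite ltr0n bin_gt0 (sM j').
  rewrite dens_dense_sets SM mulrC divfK ?gt_eqF // ler1n.
  by apply/card_gt0P; exists (val @: T); rewrite finset.in_set T_bad.
have := dens_edge_wt_le F S; rewrite SM => le2M.
have i1 : i.+1%:R^-1 <= 1 :> F by rewrite invf_le1 // ler1n.
move=> ge1; have : C <= C * \sum_(j < i.+1) b j * dens (bad j) S.
  by rewrite ler_peMr // ltW.
move: S_large le2M i1; set Z := C * _; rewrite /C.
move: (2 ^ M)%:R (i.+1%:R^-1) (dens _ _) Z => x y z Z; lra.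
Qed.

(** * Isomorphism, maxima and induced embeddings *)

Lemma hn_isomorphic (F : realType) (G H : hypergraph) :
  isomorphic G H -> hn F G = hn F H.
Proof.
case=> f f_bij fE; rewrite (hn_embedding F (bij_inj f_bij) fE) hnE; congr dens.
apply/setP => y; rewrite !inE; apply/imsetP.
by case: f_bij => h _ hK; exists (h y); rewrite ?inE ?hK.
Qed.

Lemma isomorphic_ord (G : hypergraph) (n : nat) : #|vert G| = n ->
  exists E : {set {set 'I_n}}, isomorphic G (Hypergraph E).
Proof.
move=> Gn; pose f (x : vert G) : 'I_n := cast_ord Gn (enum_rank x).
have f_bij : bijective f.
  by exists (fun i => enum_val (cast_ord (esym Gn) i)) => x;
    rewrite /f ?cast_ordK ?enum_rankK // enum_valK cast_ordKV.
exists [set f @: e | e : {set vert G} in edges G]%SET, f => // e.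
by rewrite mem_imset //; exact/imset_inj/bij_inj.
Qed.

(** Up to isomorphism only the finitely many graphs on ['I_n] compete. *)
Lemma pi_n_exists (F : realType) (P : hypergraph -> Prop) (n : nat) :
  (forall G H, isomorphic G H -> P G -> P H) -> (exists G, members P n G) ->
  exists x : F, is_pi_n P n x.
Proof.
move=> isoP [G0 [PG0 G0n]]; have [E0 iso0] := isomorphic_ord G0n.
pose Q (E : {set {set 'I_n}}) := `[< P (Hypergraph E) >].
have QE0 : Q E0 by apply/asboolP; apply: isoP iso0 PG0.
case: (@arg_maxP _ F _ E0 Q (fun E => hn F (Hypergraph E)) QE0) => E /asboolP PE maxE.
exists (hn F (Hypergraph E)); split.
  by exists (Hypergraph E) => //; split => //=; rewrite card_ord.
move=> G [PG Gn]; have [E' iso'] := isomorphic_ord Gn.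
by rewrite (hn_isomorphic F iso'); apply: maxE; apply/asboolP; apply: isoP iso' PG.
Qed.

(** Isomorphism with an induced subgraph of [K]: unlike in [subgraph], non-edges are preserved
    too. *)
Definition embeds (G K : hypergraph) : Prop :=
  exists2 f : vert G -> vert K, injective f &
    forall e : {set vert G}, (f @: e \in edges K) = (e \in edges G).

Lemma embeds_trans (G H K : hypergraph) : embeds G H -> embeds H K -> embeds G K.
Proof.
move=> [f f_inj fE] [h h_inj hE]; exists (h \o f) => [|e]; first exact: inj_comp.
by rewrite imset_comp hE fE.
Qed.

Lemma embeds_induced (G : hypergraph) (S : {set vert G}) :
  embeds (induced_subgraph S) G.
Proof. by exists val => [|e]; [exact: val_inj | rewrite inE]. Qed.

Lemma isomorphic_embeds (G H : hypergraph) : isomorphic G H -> embeds H G.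
Proof.
move=> [f [h fK hK] fE]; exists h => [|e]; first exact: can_inj hK.
by rewrite -fE -imset_comp (eq_imset (g := id)) ?imset_id.
Qed.

Lemma invS_bound_le (F : realType) (e : F) (i : nat) :
  0 < e -> (Num.bound e^-1 <= i)%N -> i.+1%:R^-1 <= e.
Proof.
move=> e0 ei; rewrite -[leRHS]invrK lef_pV2 ?posrE ?ltr0n ?invr_gt0 //; apply: ltW.
apply: lt_le_trans (_ : (Num.bound e^-1)%:R <= _).
  by apply: archi_boundP; rewrite invr_ge0 ltW.
by rewrite ler_nat ltnW.
Qed.

(** * The two implications *)

Lemma hereditary_pi_not_strong_jump (F : realType) (R : {fset nat}) (a : F)
    (P : hypergraph -> Prop) :
  is_property R P -> hereditary P -> is_pi P a -> ~ strong_jump R a.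
Proof.
move=> [PR _] herP [u uP ua] [c c0 jump].
have /cvgrPdist_lt/(_ c c0)[N _ uN] := ua.
(* Taking [t] at least [N] makes [u t < a + c] available for the contradiction. *)
have [n0 n0P] := jump (maxn (\max_(r <- R) r) N) (leq_maxl _ _).
have [[G [PG Gn] hG] _] := uP (maxn n0 N).
have [||H [[f f_inj fE] Ht Hge]] := n0P G _ (PR _ PG).
- by rewrite Gn leq_maxl.
- have := uN (maxn n0 N) (leq_maxr _ _); rewrite /= hG ltr_distl => /andP[_]; lra.
set t := maxn _ N in Ht.
have := uN t (leq_maxr _ _); rewrite /= ltr_distl => /andP[ut _].
(* The copy of [H] need not be induced; the subgraph of [G] induced on its vertices lies in [P] and
   is at least as dense. *)
have le_ut : hn F (induced_subgraph (f @: [set: vert H]%SET)) <= u t.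
  by apply: (uP t).2; split; [exact: herP | rewrite card_induced card_imset // cardsT].
have := hn_subgraph F f_inj fE; rewrite -hn_induced; lra.
Qed.

Lemma hereditary_pi_of_not_strong_jump (F : realType) (R : {fset nat}) (a : F) :
  0 <= a -> ~ strong_jump R a ->
  exists P : hypergraph -> Prop, [/\ is_property R P, hereditary P & is_pi P a].
Proof.
move=> a0 nj; have [s ks /choice[K KP]] := locally_sparse_graphs a0 nj.
set k := \max_(r <- R) r in ks.
have RK i : is_Rgraph R (K i) by case: (KP i).
have Kk i (e : {set vert (K i)}) : e \in edges (K i) -> (#|e| <= k)%N.
  exact: Rgraph_edge_card.
pose P G := exists i, embeds G (K i).
have PP : is_property R P.
  split=> [G [i [f f_inj fE]] e|G H GH [i Gi]].
    by rewrite -fE => /RK; rewrite card_imset.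
  by exists i; apply: embeds_trans Gi; exact: isomorphic_embeds.
have herP : hereditary P.
  by move=> G S [i Gi]; exists i; apply: embeds_trans Gi; exact: embeds_induced.
have PK i (S : {set vert (K i)}) : members P #|S| (induced_subgraph S).
  by split; [exists i; exact: embeds_induced | rewrite card_induced].
have /choice[u uP] : forall n, exists x : F, is_pi_n P n x.
  move=> n; apply: pi_n_exists; first exact: PP.2.
  have [_ nK _ _] := KP n; have [|S _ <-] := @subset_of_card _ [set: vert (K n)]%SET n.
    by rewrite cardsT.
  by exists (induced_subgraph S).
(* Averaging [K i] down to [n] vertices, with [i] arbitrarily large, gives members of density at
   least [a - e] for every [e > 0]. *)
have u_ge n : (k <= n)%N -> a <= u n.
  move=> kn; apply/ler_addgt0Pr => e e0.
  pose i := maxn n (Num.bound e^-1); have [_ iK aK _] := KP i.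
  have [||S [_ Sn S_ge]] :=
      @dens_averaging F _ (@edge_wt F (K i)) n [set: vert (K i)]%SET.
  - by move=> f; apply: edge_wt_supp => f' /Kk /leq_trans; apply.
  - by rewrite cardsT (leq_trans _ iK) // leq_maxl.
  have := PK i S; rewrite Sn => /(uP n).2; rewrite hn_induced.
  have ie : i.+1%:R^-1 <= e by rewrite invS_bound_le // leq_maxr.
  move: S_ge aK ie; rewrite -hnE.
  move: (hn F (K i)) (dens _ _) (i.+1%:R^-1) => x y z; lra.
have u_lt j : exists N, forall n, (N <= n)%N -> u n < a + j.+1%:R^-1.
  (* Beyond the sizes of all [K i] with [i < j], a member embeds in some [K i] with [j <= i], whose
     [s j]-sets are all sparse; averaging down to [s j] vertices transfers the bound to the
     member. *)
  exists (maxn (s j) (\max_(i < j) #|vert (K i)|).+1) => n.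
  rewrite geq_max => /andP[sn Kn].
  have [[G [[i [f f_inj fE]] Gn] <-] _] := uP n.
  have cardU : #|f @: [set: vert G]%SET| = n by rewrite card_imset // cardsT.
  have ji : (j <= i)%N.
    rewrite leqNgt; apply/negP => ij.
    have : (n <= #|vert (K i)|)%N by rewrite -cardU max_card.
    apply/negP; rewrite -ltnNge; apply: leq_trans Kn.
    by rewrite ltnS (leq_bigmax (Ordinal ij)).
  rewrite (hn_embedding F f_inj fE).
  have [||S [_ Ss S_ge]] :=
      @dens_averaging F _ (@edge_wt F (K i)) (s j) (f @: [set: vert G]%SET).
  - by move=> e; apply: edge_wt_supp => e' /Kk /leq_trans; apply.
  - by rewrite cardU.
  have [_ _ _ /(_ j S ji Ss)] := KP i; exact: le_lt_trans.
exists P; split=> //; exists u => //; apply/cvgrPdist_le => e e0.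
have [N uN] := u_lt (Num.bound e^-1).
exists (maxn k N) => // n /=; rewrite geq_max => /andP[/u_ge un_ge /uN un_lt].
have {un_lt} un_lt : u n < a + e.
  by apply: lt_le_trans un_lt _; rewrite lerD2l invS_bound_le.
by rewrite ler_distl; apply/andP; split; lra.
Qed.

Theorem theorem7 (F : realType) (R : {fset nat})
    (R_pos : forall r : nat, r \in R -> (0 < r)%N)
    (a : F) (a_range : 0 <= a <= (#|` R|)%:R) :
  ~ strong_jump R a <->
  exists P : hypergraph -> Prop,
    [/\ is_property R P, hereditary P & is_pi P a].
Proof.
split=> [|[P [PR herP piP]]]; last exact: hereditary_pi_not_strong_jump piP.
by case/andP: a_range => a0 _; exact: hereditary_pi_of_not_strong_jump.
Qed.
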